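(* Let $\mathbf{s}: d_1\le d_2\le\cdots\le d_n$ be a tree degree sequence of length $n>2$, and let $l$ be the number of entries of $\mathbf{s}$ equal to $1$. Let $\mathcal{T}_{\mathbf{s}}$ be the set of all trees with degree sequence $\mathbf{s}$. Define $\nu_M(\mathcal{T}_{\mathbf{s}})=\max_{T\in\mathcal{T}_{\mathbf{s}}}\nu(T)$, $\eta_m(\mathcal{T}_{\mathbf{s}})=\min_{T\in\mathcal{T}_{\mathbf{s}}}\eta(T)$ and $\alpha_m(\mathcal{T}_{\mathbf{s}})=\min_{T\in\mathcal{T}_{\mathbf{s}}}\alpha(T)$. Then \[ \nu_M(\mathcal{T}_{\mathbf{s}})=\begin{cases} n-l & \text{if } l\ge \lceil n/2\rceil,\\ \lfloor n/2\rfloor & \text{if } l<\lceil n/2\rceil,\end{cases} \qquad \eta_m(\mathcal{T}_{\mathbf{s}})=\begin{cases} 2l-n & \text{if } l\ge \lceil n/2\rceil,\\ 1 & \text{if } l<\lceil n/2\rceil \text{ and } n \text{ is odd},\\ 0 & \text{if } l<\lceil n/2\rceil \text{ and } n \text{ is even},\end{cases} \] and \[ \alpha_m(\mathcal{T}_{\mathbf{s}})=\begin{cases} l & \text{if } l\ge \lceil n/2\rceil,\\ \lceil n/2\rceil & \text{if } l<\lceil n/2\rceil.\end{cases} \]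
   Context: A tree degree sequence of length $n$ is a degree sequence (of some graph) $d_1\le d_2\le\dots\le d_n$ with $\sum_{i=1}^n d_i=2n-2$. For a graph $G$: $\nu(G)$ is the matching number (maximum size of a matching), $\alpha(G)$ is the independence number, and the nullity $\eta(G)$ is the multiplicity of the eigenvalue $0$ of the adjacency matrix of $G$.
   Formalization: All entries of the tree degree sequence are additionally required to be positive; otherwise a sequence such as 0,2,2,2 (triangle plus isolated vertex) qualifies, but no tree has it and the maximum and minima are undefined. *)

(* Defs.v *)
From mathcomp Require Import all_boot all_order all_algebra.

Set Implicit Arguments.
Unset Strict Implicit.
Unset Printing Implicit Defensive.

Import GRing.Theory Num.Theory.

Record sgraph := SGraph {
  vertex :> finType;
  adj : rel vertex;
  adj_sym : symmetric adj;
  adj_irrefl : irreflexive adj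
}.

Arguments adj {s}.

Section Graph.

Variable G : sgraph.
Implicit Types (x y : G) (A : {set G}) (M : {set {set G}}).

Definition degree x : nat := #|[set y | adj x y]|.

Definition degree_sequence : seq nat := sort leq [seq degree x | x : G].

Definition edges : {set {set G}} :=
  [set e | [exists x, [exists y, adj x y && (e == [set x; y])]]].

Definition is_matching M : bool := (M \subset edges) && trivIset M.

Definition matching_number : nat := \max_(M | is_matching M) #|M|.

Definition independent A : bool := [forall x in A, forall y in A, ~~ adj x y].

Definition independence_number : nat := \max_(A | independent A) #|A|.

Definition connected : Prop := 0 < #|G| /\ forall x y, connect adj x y.

(* [ucycle] alone also accepts the sequences [::] and [:: x; y] with x, y
   adjacent, whence the bound on the size. *)
Definition acyclic : Prop := forall c : seq G, 2 < size c -> ~ ucycle adj c.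

Definition is_tree : Prop := connected /\ acyclic.

Definition adjacency_matrix (R : nzRingType) : 'M[R]_#|G| :=
  (\matrix_(i, j) (adj (enum_val i) (enum_val j))%:R)%R.

Definition nullity (R : rcfType) : nat :=
  mup 0%R (char_poly (adjacency_matrix R)).

End Graph.

(* Entries are required to be positive: without this, 0, 2, 2, 2 (a triangle
   and an isolated vertex) would qualify, although no tree realizes it. *)
Definition tree_degree_sequence n (s : n.-tuple nat) : Prop :=
  [/\ sorted leq s,
      exists G : sgraph, degree_sequence G = s,
      all (leq 1) s
    & sumn s + 2 = 2 * n].

Definition trees_with n (s : n.-tuple nat) (T : sgraph) : Prop :=
  is_tree T /\ degree_sequence T = s.

Definition is_maximum (P : sgraph -> Prop) (f : sgraph -> nat) (m : nat) :=
  (exists2 G, P G & f G = m) /\ (forall G, P G -> f G <= m).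

Definition is_minimum (P : sgraph -> Prop) (f : sgraph -> nat) (m : nat) :=
  (exists2 G, P G & f G = m) /\ (forall G, P G -> m <= f G).

(* Main.v *)
Require Import Defs.
From mathcomp Require Import all_boot all_order all_algebra zify.

(* Put a = max(l, ceil(n/2)). Every tree with degree sequence s has an
   independent set of size at least a: the leaves, or a set obtained by greedily
   picking vertices with at most one remaining neighbour. An independent set S
   gives |M| <= n - |S| for every matching M, and the adjacency matrix A has
   rank at most 2 (n - |S|). Conversely, in an acyclic graph a matching M forces
   rank A >= 2 |M|: a kernel vector supported on the vertices of M vanishes, by
   peeling off leaves. As A is symmetric, the nullity is n - rank A. So all
   three extrema are attained by any tree with a matching of size n - a.
   To build one, attach vertices one at a time: first, in decreasing order of
   degree, the k non-leaves, where each of the last min(k, l) is followed at once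
   by a leaf attached to it, and then the remaining leaves. Pairing consecutive
   vertices, backwards from position min(n, 2k), gives the matching. *)

Set Implicit Arguments.
Unset Strict Implicit.
Unset Printing Implicit Defensive.

Import GRing.Theory Num.Theory.

(** * Nullity of a symmetric matrix *)

Section LinearAlgebra.

Local Open Scope ring_scope.

(** The block matrix with rows [(x, B)] and [(C, 1)] becomes block triangular after right
    multiplication by either of two block triangular matrices; this computes its determinant in two
    ways. *)
Lemma det_scalar_sub_mulmxC (K : comNzRingType) m n (x : K)
    (B : 'M[K]_(m, n)) (C : 'M[K]_(n, m)) :
  \det (x%:M - B *m C) * x ^+ n = x ^+ m * \det (x%:M - C *m B).
Proof.
have E1 : block_mx x%:M B C 1%:M *m block_mx 1%:M 0 (- C) 1%:M
        = block_mx (x%:M - B *m C) B 0 1%:M.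
  by rewrite mulmx_block !mulmx1 !mulmx0 !mul1mx !add0r mulmxN subrr.
have E2 : block_mx x%:M B C 1%:M *m block_mx 1%:M (- B) 0 x%:M
        = block_mx x%:M 0 C (x%:M - C *m B).
  rewrite mulmx_block !mulmx1 !mulmx0 !mul1mx !addr0 !mulmxN addrC.
  by rewrite mul_mx_scalar mul_scalar_mx subrr addrC.
have /(congr1 determinant) := E1; have /(congr1 determinant) := E2.
rewrite !det_mulmx !det_ublock !det_lblock !det1 !det_scalar !mulr1 !mul1r.
by move=> e2 <-.
Qed.

Lemma char_poly_mulmxC (K : comNzRingType) m n
    (B : 'M[K]_(m, n)) (C : 'M[K]_(n, m)) :
  char_poly (B *m C) * 'X^n = 'X^m * char_poly (C *m B).
Proof.
by rewrite /char_poly /char_poly_mx !map_mxM; apply: det_scalar_sub_mulmxC.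
Qed.

Lemma row_dot_eq0 (F : realDomainType) n (u : 'rV[F]_n) :
  u *m u^T = 0 -> u = 0.
Proof.
move=> /matrixP/(_ 0 0); rewrite !mxE => uu0.
have sq_ge0 i : true -> 0 <= u 0 i * u^T i 0.
  by move=> _; rewrite mxE -expr2 sqr_ge0.
apply/rowP => i; have := psumr_eq0P sq_ge0 uu0 (i := i) isT.
by rewrite !mxE => /eqP; rewrite mulf_eq0 orbb => /eqP.
Qed.

(** By symmetry the row space of [A] is orthogonal to its kernel, so over an ordered field the two
    meet only in 0. *)
Lemma mxrank_sym_sqr (F : realFieldType) n (A : 'M[F]_n) :
  A^T = A -> \rank (A *m A) = \rank A.
Proof.
move=> symA; rewrite -[RHS](mxrank_mul_ker A A).
suff -> : (A :&: kermx A)%MS = 0 by rewrite mxrank0 addn0.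
apply/eqP/rowV0P => u; rewrite sub_capmx sub_kermx.
case/andP=> /submxP[w uE] /eqP uA.
apply: row_dot_eq0.
by rewrite {1}uE -mulmxA -{1}symA -trmx_mul uA trmx0 mulmx0.
Qed.

(** Factor [A = C *m B] through dimension [r]. Then [B *m C] is invertible, because [A *m A] still
    has rank [r], and [char_poly_mulmxC] yields the multiplicity [n - r]. *)
Lemma mup0_char_poly_sym (F : realFieldType) n (A : 'M[F]_n) :
  A^T = A -> mup 0 (char_poly A) = (n - \rank A)%N.
Proof.
move=> symA; set r := \rank A.
pose C := col_base A; pose B := row_base A.
have AE : C *m B = A by apply: mulmx_base.
have unitBC : B *m C \in unitmx.
  rewrite -row_free_unit /row_free eqn_leq rank_leq_row /=.
  rewrite -[X in (X <= _)%N](mxrank_sym_sqr symA).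
  rewrite -{1 2}AE mulmxA -(mulmxA C).
  exact: leq_trans (mxrankM_maxl _ _) (mxrankM_maxr _ _).
have BC0 : ~~ root (char_poly (B *m C)) 0.
  rewrite /root horner_coef0 char_poly_det mulf_neq0 ?signr_eq0 //.
  by rewrite -unitfE -unitmxE.
have nz M (M0 : 'M[F]_M) : char_poly M0 != 0.
  by rewrite monic_neq0 ?char_poly_monic.
have mupXn k : mup 0 ('X^k : {poly F}) = k.
  by rewrite -['X]subr0 -polyC0 mup_XsubCX eqxx.
have := congr1 (mup 0) (char_poly_mulmxC C B).
rewrite AE (mupMl _ BC0) mupM ?nz ?monic_neq0 ?monicXn // !mupXn => nE.
by rewrite -[LHS](addnK r) nE.
Qed.

End LinearAlgebra.

(** * Matchings and independent sets in acyclic graphs *)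

Section Graphs.

Variable G : sgraph.
Implicit Types (x y : G) (S A : {set G}) (M : {set {set G}}).

Lemma indepP S : reflect {in S &, forall x y, ~~ adj x y} (independent S).
Proof.
apply: (iffP forall_inP) => [h x y xS yS|h x xS].
  exact: (forall_inP (h x xS)).
by apply/forall_inP => y yS; apply: h.
Qed.

Lemma edgeP (e : {set G}) :
  reflect (exists x y, adj x y /\ e = [set x; y]) (e \in edges G).
Proof.
rewrite inE; apply: (iffP existsP) => [[x /existsP[y /andP[xy /eqP ->]]]|].
  by exists x, y.
by move=> [x [y [xy ->]]]; exists x; apply/existsP; exists y; rewrite xy eqxx.
Qed.

Lemma adj_neq x y : adj x y -> x != y.
Proof. by apply: contraTneq => ->; rewrite adj_irrefl. Qed.

(** Each edge has an endpoint outside [S], and the edges of [M] are disjoint. *)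
Lemma matching_cardU_indep S M :
  independent S -> is_matching M -> #|M| + #|S| <= #|G|.
Proof.
move=> /indepP indS /andP[/subsetP Medges tiM].
suff : #|M| <= #|~: S|.
  by rewrite [#|~: S|]cardsCs setCK; have := max_card S; lia.
rewrite -sum1_card.
apply: (@leq_trans (\sum_(e in M) \sum_(x in e) (x \notin S))).
  apply: leq_sum => e /Medges /edgeP[x [y [xy ->]]].
  rewrite big_setU1 ?inE ?adj_neq // big_set1.
  have [xS|] := boolP (x \in S) => //=.
  by have [yS|] := boolP (y \in S) => //=; move: (indS x y xS yS); rewrite xy.
rewrite -big_trivIset //= -big_mkcondr /= sum1_card.
by apply/subset_leq_card/subsetP => x; rewrite !inE => /andP[].
Qed.

Lemma card_cover_matching M : is_matching M -> #|cover M| = 2 * #|M|.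
Proof.
move=> /andP[/subsetP Medges /eqP <-]; rewrite mulnC -sum_nat_const.
apply: eq_bigr => e /Medges /edgeP[x [y [xy ->]]].
by rewrite cards2 adj_neq.
Qed.

(* Otherwise a path inside A can be prolonged forever. *)
Lemma acyclic_leaf A :
  acyclic G -> A != set0 -> exists2 x, x \in A & #|[set y in A | adj x y]| <= 1.
Proof.
move=> acG /set0Pn[x0 x0A]; apply/exists_inP; apply: contraT.
rewrite negb_exists_in => /forall_inP deg2.
have long k : exists x p, [/\ size p = k, path adj x p, uniq (x :: p)
                            & {subset x :: p <= A}].
  elim: k => [|k [x [p [sz_p xp Up pA]]]].
    by exists x0, [::]; split=> // z; rewrite inE => /eqP ->.
  have xA : x \in A by apply: pA; rewrite mem_head.
  (* The path grows at [x], and [head x p] is the vertex next to [x] on it ([x] itself if [p] is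
     empty). Avoiding it ensures that a cycle closed by [y] has at least three vertices. *)
  have [y /andP[yA xy] ney] : exists2 y, (y \in A) && adj x y & y != head x p.
    have := deg2 x xA; rewrite -ltnNge => deg2x.
    have : 0 < #|[set y in A | adj x y] :\ head x p|.
      by move: deg2x; rewrite (cardsD1 (head x p)); case: (_ \in _); lia.
    by case/card_gt0P => y; rewrite !inE => /andP[]; exists y.
  have [yp|yNp] := boolP (y \in x :: p); last first.
    exists y, (x :: p); split; first by rewrite /= sz_p.
    - by rewrite /= adj_sym xy.
    - by rewrite cons_uniq yNp.
    - by move=> z; rewrite inE => /predU1P[->|/pA].
  have {}yp : y \in p by move: yp; rewrite inE eq_sym (negbTE (adj_neq xy)).
  case/splitPr: yp xp Up ney {sz_p pA} => p1 p2 xp Up ney; exfalso.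
  apply: (acG (x :: rcons p1 y)).
    by case: p1 ney {xp Up} => [|z p1]; rewrite /= ?eqxx // size_rcons.
  rewrite -cat_rcons cat_path in xp; case/andP: xp => xp _.
  rewrite -cat_rcons -cat_cons cat_uniq in Up; case/andP: Up => Up _.
  by rewrite /ucycle Up andbT /= rcons_path xp last_rcons adj_sym.
have [x [p [sz_p _ Up _]]] := long #|G|.
by have := max_card (mem (x :: p)); rewrite (card_uniqP Up) /= sz_p ltnn.
Qed.

Lemma acyclic_indep :
  acyclic G -> exists2 S : {set G}, independent S & uphalf #|G| <= #|S|.
Proof.
(* Generalized to induced subgraphs for the induction: each chosen [x] deletes itself and at most
   one neighbour, whence the factor 2. *)
move=> acG; suff : forall k A, #|A| <= k ->
    exists S, [/\ S \subset A, independent S & #|A| <= 2 * #|S|].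
  case/(_ _ [set: G] (leqnn _)) => S [_ indS]; rewrite cardsT => h.
  by exists S => //; lia.
elim=> [|k IHk] A.
  rewrite leqn0 cards_eq0 => /eqP ->; exists set0; rewrite cards0; split=> //.
  by apply/indepP => x y; rewrite inE.
have [-> _|A0 cA] := eqVneq A set0; first by apply: IHk; rewrite cards0.
have [x xA dx] := acyclic_leaf acG A0.
set N := [set y in A | adj x y] in dx; pose A' := A :\: (x |: N).
have xNN : x \notin N by rewrite inE adj_irrefl andbF.
have sxN : x |: N \subset A.
  by apply/subsetP => y; rewrite !inE => /predU1P[->|/andP[]].
have cxN : #|x |: N| = #|N|.+1 by rewrite cardsU1 xNN.
have cA' : #|A| = #|A'| + #|N|.+1.
  by rewrite cardsD (setIidPr sxN) cxN subnK // -cxN subset_leq_card.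
have [|S [sSA /indepP indS cS]] := IHk A'; first lia.
exists (x |: S); split.
- by rewrite subUset sub1set xA (subset_trans sSA) ?subsetDl.
- have xS y : y \in S -> ~~ adj x y.
    move/(subsetP sSA); rewrite !inE negb_or negb_and.
    by case/andP=> /andP[_ /orP[/negP|]].
  apply/indepP => y z; rewrite !inE => /predU1P[->|yS] /predU1P[->|zS].
  + by rewrite adj_irrefl.
  + exact: xS.
  + by rewrite adj_sym xS.
  + exact: indS.
- have xNS : x \notin S.
    by apply/negP => /(subsetP sSA); rewrite !inE eqxx.
  by rewrite cardsU1 xNS /=; lia.
Qed.

Definition leaves : {set G} := [set x | degree x == 1].

(** Two adjacent leaves would form a whole connected component. *)
Lemma leaves_indep : connected G -> 2 < #|G| -> independent leaves.
Proof.
move=> [_ conG] G3; apply/indepP => x y; rewrite !inE => dx dy.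
apply/negP => xy.
have nbr (u v w : G) : degree u == 1 -> adj u v -> adj u w -> v = w.
  case/cards1P => z Nz uv uw.
  have: v \in [set y0 | adj u y0] by rewrite inE.
  have: w \in [set y0 | adj u y0] by rewrite inE.
  by rewrite Nz !inE => /eqP -> /eqP.
have cl : closed adj (mem [set x; y]).
  apply: intro_closed => [|u v uv]; first exact/sym_connect_sym/adj_sym.
  rewrite !inE => /orP[]/eqP ?; subst u.
    by rewrite (nbr _ _ _ dx uv xy) eqxx orbT.
  by rewrite adj_sym in xy; rewrite (nbr _ _ _ dy uv xy) eqxx.
have: #|G| <= #|[set x; y]|.
  apply/subset_leq_card/subsetP => z _.
  by rewrite -(closed_connect cl (conG x z)) !inE eqxx.
by rewrite cards2; case: (_ != _) G3; lia.
Qed.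

End Graphs.

(** * Rank of the adjacency matrix *)

Section AdjacencyRank.

Local Open Scope ring_scope.

Lemma mxrank_sum (F : fieldType) (I : finType) m n (P : pred I)
    (f : I -> 'M[F]_(m, n)) :
  (\rank (\sum_(i | P i) f i)%R <= \sum_(i | P i) \rank (f i))%N.
Proof.
elim/big_rec2: _ => [|i k A _ IH]; first by rewrite mxrank0.
by apply: leq_trans (mxrank_add _ _) _; rewrite leq_add2l.
Qed.

Variables (G : sgraph) (F : fieldType).
Implicit Types (S A : {set G}) (M : {set {set G}}).

Local Notation N := #|G|.
Local Notation adjm := (adjacency_matrix G F).

(** The projection onto the coordinates in [A], as a sum of rank-one matrices so that subadditivity
    bounds its rank. *)
Definition coord_proj A : 'M[F]_N :=
  \sum_(x in A) delta_mx (enum_rank x) (enum_rank x).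

Lemma coord_projE A i j :
  coord_proj A i j = ((i == j) && (enum_val i \in A))%:R.
Proof.
rewrite summxE; have [iA|iNA] := boolP (enum_val i \in A); last first.
  rewrite andbF big1 // => x xA; rewrite mxE.
  by case: eqP => // iE; case/negP: iNA; rewrite iE enum_rankK.
rewrite (bigD1 _ iA) /= big1 => [|x /andP[_ ne]].
  by rewrite mxE enum_valK eqxx /= addr0 andbT eq_sym.
by rewrite mxE; case: eqP => // iE; case/negP: ne; rewrite iE enum_rankK.
Qed.

Lemma mxrank_coord_proj A : (\rank (coord_proj A) <= #|A|)%N.
Proof.
apply: leq_trans (mxrank_sum _ _) _.
by rewrite -[X in (_ <= X)%N]sum1_card leq_sum // => x _; rewrite mxrank_delta.
Qed.

Lemma mul_coord_proj m A (B : 'M[F]_(m, N)) i j :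
  (B *m coord_proj A) i j = B i j * (enum_val j \in A)%:R.
Proof.
rewrite mxE (bigD1 j) //= coord_projE eqxx /= big1 ?addr0 // => k /negbTE kj.
by rewrite coord_projE kj mulr0.
Qed.

(** If [D] projects onto the complement of [S], independence kills the block [(1 - D) A (1 - D)] of
    the adjacency matrix [A]. Hence [A = D A + (1 - D) A D], where both terms have rank at most that
    of [D]. *)
Lemma mxrank_adj_indep S :
  independent S -> (\rank adjm <= 2 * (N - #|S|))%N.
Proof.
move=> /indepP indS; pose D := coord_proj (~: S).
have trD : D^T = D.
  apply/matrixP => i j; rewrite mxE !coord_projE eq_sym.
  by case: eqP => // ->.
have adjT : adjm^T = adjm by apply/matrixP => i j; rewrite !mxE adj_sym.
have zero : (1%:M - D) *m adjm *m (1%:M - D) = 0.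
  have mulD m (B : 'M[F]_(m, N)) i j :
      (B *m (1%:M - D)) i j = B i j * (enum_val j \in S)%:R.
    rewrite mulmxBr mulmx1 mxE [X in _ + X]mxE mul_coord_proj inE.
    by case: (_ \in S); rewrite ?mulr0 ?mulr1 ?subr0 ?subrr.
  apply/matrixP => i j; rewrite mulD -[_ *m adjm]trmxK trmx_mul.
  rewrite linearB /= trmx1.
  rewrite trD adjT [in LHS]mxE mulD !mxE.
  have [iS|] := boolP (_ \in S); last by rewrite !mulr0 mul0r.
  have [jS|] := boolP (_ \in S); last by rewrite !mulr0.
  by rewrite (negbTE (indS _ _ jS iS)) !mul0r.
have -> : adjm = D *m adjm + (1%:M - D) *m adjm *m D.
  move/eqP: zero; rewrite mulmxBr mulmx1 subr_eq0 => /eqP <-.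
  by rewrite mulmxBl mul1mx addrC subrK.
have rkD : (\rank D <= N - #|S|)%N.
  by rewrite (leq_trans (mxrank_coord_proj _)) // [#|~: _|]cardsCs setCK.
rewrite mul2n -addnn (leq_trans (mxrank_add _ _)) // leq_add //.
  exact: leq_trans (mxrankM_maxl _ _) rkD.
exact: leq_trans (mxrankM_maxr _ _) rkD.
Qed.

(* At a vertex y of cover M with a single neighbour in cover M, the equation
   forces u to vanish on that neighbour, i.e. on the partner of y in M. *)
Lemma matching_kernel0 M (u : G -> F) :
  acyclic G -> is_matching M ->
  {in cover M, forall y, \sum_(x in cover M | adj x y) u x = 0} ->
  {in cover M, forall y, u y = 0}.
Proof.
move=> acG; have [k] := ubnP #|M|; elim: k M => // k IHk M.
rewrite ltnS => cM mM u0.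
have [cov0|cov_n0] := eqVneq (cover M) set0.
  by move=> y; rewrite cov0 inE.
have [x xC dx] := acyclic_leaf acG cov_n0.
have [/subsetP Medges tiM] := andP mM.
have [e eM xe] := bigcupP xC.
have [y [xy eE]] : exists y, adj x y /\ e = [set x; y].
  have [a [b [ab eE]]] := edgeP _ (Medges _ eM).
  move: xe; rewrite eE !inE => /orP[]/eqP ->; first by exists b.
  by exists a; rewrite adj_sym ab setUC.
have yC : y \in cover M.
  by apply/bigcupP; exists e; rewrite // eE !inE eqxx orbT.
have nbr z : z \in cover M -> adj x z -> z = y.
  move=> zC xz; have /card_le1_eqP h := dx.
  by apply: h; rewrite inE ?zC ?yC.
have uy : u y = 0.
  rewrite -(u0 x xC) (bigD1 y) /= ?yC 1?adj_sym // big1 ?addr0 // => z.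
  by rewrite adj_sym => /andP[/andP[zC /nbr ->]] //; rewrite eqxx.
have covE : cover (M :\ e) = cover M :\: e by rewrite coverD1.
have mMe : is_matching (M :\ e).
  apply/andP; split; first by apply/subsetP => f /setD1P[_ /Medges].
  by apply: trivIsetS tiM; apply: subD1set.
have u0' : {in cover (M :\ e), forall z, u z = 0}.
  apply: IHk => //; first by rewrite [#|M|](cardsD1 e) eM in cM; lia.
  move=> z; rewrite covE inE eE !inE negb_or => /andP[/andP[zx zy] zC].
  (* Deleting [e] preserves the equation at [z]: [u] vanishes at [y], and [x] is not adjacent to
     [z], its only neighbour in [cover M] being [y]. *)
  rewrite -[RHS](u0 z zC) [RHS](bigID (mem e)) /= [X in X + _]big1 ?add0r.
    apply: eq_bigl => w; rewrite !inE eE !inE.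
    by case: (_ || _); rewrite /= ?andbT ?andbF.
  move=> w /andP[/andP[wC wz]]; rewrite eE !inE => /orP[]/eqP ww; subst w => //.
  by move/eqP: zy; case; apply: nbr.
have ux : u x = 0.
  rewrite -[RHS](u0 y yC) (bigD1 x) /= ?xC // [X in _ + X]big1 ?addr0 // => z.
  move=> /andP[/andP[zC zy] zx].
  apply: u0'; rewrite covE inE zC eE !inE negb_or zx andbT.
  by apply: adj_neq.
move=> z zC; have [ze|zNe] := boolP (z \in e); last first.
  by apply: u0'; rewrite covE inE zNe.
by move: ze; rewrite eE !inE => /orP[]/eqP ->.
Qed.

(** By [matching_kernel0] no nonzero kernel vector is supported on [C], so the projection onto the
    other coordinates is injective on the kernel. *)
Lemma mxrank_adj_matching M :
  acyclic G -> is_matching M -> (2 * #|M| <= \rank adjm)%N.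
Proof.
move=> acG mM; rewrite -card_cover_matching //; set C := cover M.
pose D := coord_proj (~: C).
have := mxrank_mul_ker (kermx adjm) D.
suff -> : (kermx adjm :&: kermx D)%MS = 0.
  rewrite mxrank0 addn0 mxrank_ker => rkKD.
  have := leq_trans (mxrankM_maxr (kermx adjm) D) (mxrank_coord_proj _).
  rewrite rkKD [#|~: C|]cardsCs setCK.
  by have := rank_leq_row adjm; have := max_card C; lia.
apply/eqP/rowV0P => v; rewrite sub_capmx !sub_kermx => /andP[/eqP vA /eqP vD].
pose u x := v 0 (enum_rank x).
have uC x : x \notin C -> u x = 0.
  move=> xNC; have := congr1 (fun w : 'rV_N => w 0 (enum_rank x)) vD.
  by rewrite /= mul_coord_proj enum_rankK inE xNC mulr1 mxE.
have u0 : {in C, forall y, u y = 0}.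
  apply: matching_kernel0 => // y yC.
  have := congr1 (fun w : 'rV_N => w 0 (enum_rank y)) vA.
  rewrite /= !mxE (reindex_onto enum_rank enum_val) => [|i _]; last first.
    exact: enum_valK.
  rewrite -[RHS]/0 => {2}<-; rewrite big_mkcond [RHS]big_mkcond.
  apply: eq_bigr => x _.
  rewrite !mxE !enum_rankK eqxx /= -/(u x).
  have [xC|/uC ->] := boolP (x \in C); last by rewrite /= mul0r.
  by case: adj; rewrite ?mulr1 ?mulr0.
apply/rowP => i; rewrite mxE -[i]enum_valK -/(u (enum_val i)).
by have [/u0|/uC] := boolP (enum_val i \in C).
Qed.

End AdjacencyRank.

Lemma nullity_rank (G : sgraph) (R : rcfType) :
  nullity G R = #|G| - \rank (adjacency_matrix G R).
Proof.
by apply/mup0_char_poly_sym/matrixP => i j; rewrite !mxE adj_sym.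
Qed.

Lemma nullity_indep (G : sgraph) (R : rcfType) (S : {set G}) :
  independent S -> 2 * #|S| - #|G| <= nullity G R.
Proof.
move=> indS; rewrite nullity_rank.
apply: leq_trans (leq_sub2l _ (mxrank_adj_indep R indS)).
by have := max_card S; lia.
Qed.

Lemma nullity_matching (G : sgraph) (R : rcfType) (M : {set {set G}}) :
  acyclic G -> is_matching M -> nullity G R <= #|G| - 2 * #|M|.
Proof.
move=> acG mM; rewrite nullity_rank.
exact: leq_sub2l (mxrank_adj_matching R acG mM).
Qed.

(** * Trees given by a parent function *)

(* The degree of i in the tree with root 0 on 0, ..., m - 1 where p j is the
   parent of j; the value p 0 is ignored. *)
Definition parent_degree (p : nat -> nat) m i :=
  (0 < i) + \sum_(0 <= j < m) ((0 < j) && (p j == i)).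

Section ParentTree.

Variables (n : nat) (p : nat -> nat).
Hypothesis p_lt : forall i, 0 < i < n -> p i < i.

Definition parent_adj : rel 'I_n :=
  fun i j => ((0 < i) && (p i == j)) || ((0 < j) && (p j == i)).

Lemma parent_adj_sym : symmetric parent_adj.
Proof. by move=> i j; rewrite /parent_adj orbC. Qed.

Lemma parent_adj_irrefl : irreflexive parent_adj.
Proof.
move=> i; rewrite /parent_adj orbb; apply/negP => /andP[i0 /eqP pi].
by have := @p_lt i; rewrite i0 ltn_ord pi ltnn => /(_ isT).
Qed.

Definition parent_tree : sgraph := SGraph parent_adj_sym parent_adj_irrefl.

Lemma parent_tree_connected : 0 < n -> connected parent_tree.
Proof.
move=> n_gt0; split; first by rewrite card_ord.
have root x : connect (@adj parent_tree) (Ordinal n_gt0) x.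
  case: x => i; elim/ltn_ind: i => i IHi i_n.
  have [i0|i0] := posnP i.
    by rewrite (_ : Ordinal i_n = Ordinal n_gt0) ?connect0 //; apply/val_inj.
  have pi : p i < i by apply: p_lt; rewrite i0.
  apply: connect_trans (IHi _ pi (ltn_trans pi i_n)) (connect1 _).
  by rewrite /= /parent_adj /= i0 eqxx orbT.
move=> x y; apply: connect_trans (root y).
by rewrite (sym_connect_sym parent_adj_sym).
Qed.

(** Both cycle neighbours of the largest vertex [x] of a cycle would be its parent, since a child of
    [x] is larger than [x]. *)
Lemma parent_tree_acyclic : acyclic parent_tree.
Proof.
move=> c c3 cyc.
have [x0 x0c] : exists x0, x0 \in c.
  by case: c c3 {cyc} => // x0 c _; exists x0; rewrite mem_head.
pose x := [arg max_(i > x0 in c) (i : nat)].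
have [xc xmax] : x \in c /\ forall y, y \in c -> (y : nat) <= x.
  by rewrite /x; case: arg_maxnP.
have xP y : y \in c -> parent_adj x y -> p x = y.
  move=> yc /orP[/andP[_ /eqP //]|/andP[y0 /eqP py]].
  have := @p_lt y; rewrite y0 ltn_ord py => /(_ isT).
  by rewrite ltnNge xmax.
have [i c' rotc] := rot_to xc.
have cycx : ucycle parent_adj (x :: c') by rewrite -rotc rot_ucycle.
have memc y : y \in x :: c' -> y \in c by rewrite -rotc mem_rot.
have := c3; rewrite -(size_rot i) rotc.
case/lastP: c' cycx memc {rotc} => // c' z.
case: c' => // y c' /andP[/= /andP[xy]].
rewrite rcons_path last_rcons => /andP[_ zx].
move=> /and3P[_ yNz _] memc _.
have py : p x = y by apply: xP; rewrite // memc // !inE eqxx orbT.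
have pz : p x = z.
  apply: xP; rewrite 1?parent_adj_sym // memc //.
  by rewrite !inE mem_rcons mem_head !orbT.
case/negP: yNz; rewrite (_ : y = z) ?mem_rcons ?mem_head //.
by apply/val_inj; rewrite /= -py.
Qed.

Lemma parent_tree_degree (i : 'I_n) :
  @degree parent_tree i = parent_degree p n i.
Proof.
rewrite /degree /parent_degree -sum1_card big_mkord.
have -> : (0 < i : nat) = \sum_(j < n) ((0 < i) && (p i == j)).
  have [->|i0] := posnP i; first by rewrite big1.
  have pi : p i < n by apply: ltn_trans (ltn_ord i); apply: p_lt; rewrite i0 /=.
  rewrite (bigD1 (Ordinal pi)) //= eqxx big1 // => j /eqP ne.
  by case: eqP => // E; case: ne; apply/val_inj.
rewrite -big_split big_mkcond /=; apply: eq_bigr => j _.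
rewrite inE /= /parent_adj.
have [/andP[i0 /eqP pi]|_] := boolP ((0 < i) && _); last by case: (_ && _).
have [/andP[j0 /eqP pj]|] //= := boolP ((0 < j) && _).
have := @p_lt i; have := @p_lt j; rewrite i0 j0 !ltn_ord pi pj.
by move=> /(_ isT) ij /(_ isT); rewrite ltnNge ltnW.
Qed.

Lemma parent_tree_degree_sequence (d : seq nat) :
  size d = n ->
  (forall i, i < n -> nth 0 d i = parent_degree p n i) ->
  degree_sequence parent_tree = sort leq d.
Proof.
move=> sz_d dE; congr sort.
rewrite -[RHS](mkseq_nth 0) sz_d /mkseq -val_enum_ord -map_comp.
by apply: eq_map => i /=; rewrite parent_tree_degree dE.
Qed.

(** The matching pairs [b - 1] with [b - 2], [b - 3] with [b - 4], and so on; for odd [b] the root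
    is left out. Truncated subtraction makes the condition on [p] vacuous for [i >= b]. *)
Lemma parent_tree_matching b :
  b <= n -> (forall i, 0 < i -> odd (b - i) -> p i = i.-1) ->
  b./2 <= matching_number parent_tree.
Proof.
move=> bn pE.
have lt1 (j : 'I_b./2) : b - (2 * j + 1) < n by have := ltn_ord j; lia.
have lt2 (j : 'I_b./2) : b - (2 * j + 2) < n by have := ltn_ord j; lia.
pose f j : {set parent_tree} := [set Ordinal (lt1 j); Ordinal (lt2 j)].
have [] : trivIset [set f j | j : 'I_b./2] /\ {in 'I_b./2 &, injective f}.
  apply: trivIimset => [i j _ _ ne|].
    rewrite -setI_eq0; apply/eqP/setP => x; rewrite !inE; apply/negP.
    move=> /andP[/orP[]/eqP -> /orP[]/eqP[]]; move: ne; rewrite -val_eqE /=;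
      by have := ltn_ord i; have := ltn_ord j; lia.
  by apply/negP => /imsetP[j _ /setP/(_ (Ordinal (lt1 j)))]; rewrite !inE eqxx.
move=> tiM injf; rewrite -[b./2]card_ord -(card_in_imset injf).
apply: (bigmax_sup [set f j | j : 'I_b./2]) => //.
apply/andP; split=> //; apply/subsetP => _ /imsetP[j _ ->].
apply/edgeP; exists (Ordinal (lt1 j)), (Ordinal (lt2 j)); split=> //=.
have j_lt := ltn_ord j.
rewrite /parent_adj /= pE; lia.
Qed.

End ParentTree.

(** * Trees with prescribed degrees *)

Section Realization.

Lemma eq_parent_degree p q m i :
  (forall j, j < m -> p j = q j) -> parent_degree p m i = parent_degree q m i.
Proof.
move=> pq; congr addn; rewrite !big_mkord; apply: eq_bigr => j _.
by rewrite pq.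
Qed.

Lemma parent_degreeS p m i : parent_degree p m.+1 i =
  parent_degree p m i + ((0 < m) && (p m == i)).
Proof. by rewrite /parent_degree big_nat_recr //= addnA. Qed.

Lemma parent_degree_ge p m i :
  (forall j, 0 < j < m -> p j < j) -> m <= i.+1 ->
  parent_degree p m i = (0 < i).
Proof.
move=> p_lt mi; rewrite /parent_degree big_nat big1 ?addn0 // => j /= jm.
apply/eqP; rewrite eqb0; apply/negP => /andP[j0 /eqP pj].
by have := @p_lt j; rewrite pj j0 /=; lia.
Qed.

Lemma sum_parent_degree p m :
  (forall j, 0 < j < m.+1 -> p j < j) ->
  \sum_(0 <= i < m.+1) parent_degree p m.+1 i = 2 * m.
Proof.
elim: m => [|m IHm] p_lt; first by rewrite big_nat1 parent_degree_ge.
have p_lt' j : 0 < j < m.+1 -> p j < j by move=> jm; apply: p_lt; lia.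
have pm : p m.+1 < m.+1 by apply: p_lt; lia.
rewrite big_nat_recr //= parent_degree_ge //.
under eq_big_nat => i _ do rewrite parent_degreeS /=.
rewrite big_split /= IHm // big_mkord (bigD1 (Ordinal pm)) //= eqxx.
rewrite big1 => [|i ne]; first lia.
by apply/eqP; rewrite eqb0; apply: contra ne => /eqP E; rewrite -val_eqE /= E.
Qed.

Variables (d : nat -> nat) (C : pred nat).

(* The vertices are attached one at a time, each to a vertex that has not yet
   reached its prescribed degree; a vertex i with C i is attached to i - 1,
   which is possible because i - 1 has no other child yet. *)
Lemma attach_parents m :
  (forall i, i <= m -> 0 < d i) ->
  (forall i, 0 < i <= m -> C i -> (0 < i.-1) < d i.-1) ->
  (forall i, 0 < i <= m -> 2 * i.-1 < \sum_(0 <= j < i) d j) ->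
  exists p, [/\ forall i, 0 < i <= m -> p i < i,
    forall i, 0 < i <= m -> C i -> p i = i.-1
    & forall i, i <= m -> parent_degree p m.+1 i <= d i].
Proof.
elim: m => [|m IHm] d_gt0 dC dsum.
  exists id; split=> i; [lia | lia |].
  by rewrite leqn0 => /eqP ->; rewrite parent_degree_ge // => j; lia.
have [i im|i im|i im|p [p_lt pC pd]] := IHm.
- by apply: d_gt0; lia.
- by apply: dC; lia.
- by apply: dsum; lia.
have p_lt' j : 0 < j < m.+1 -> p j < j by move=> jm; apply: p_lt; lia.
have [v vm [dv vC]] : exists2 v, v <= m &
    parent_degree p m.+1 v < d v /\ (C m.+1 -> v = m).
  have [Cm|NCm] := boolP (C m.+1).
    exists m => //; split=> //; rewrite parent_degree_ge //.
    by apply: (dC m.+1); lia.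
  (* The current degrees sum to only [2 * m], so some vertex still has room. *)
  have : \sum_(0 <= i < m.+1) parent_degree p m.+1 i < \sum_(0 <= j < m.+1) d j.
    by rewrite sum_parent_degree //; apply: (dsum m.+1); lia.
  have [/existsP[v dv] _|] :=
    boolP [exists v : 'I_m.+1, parent_degree p m.+1 v < d v].
    by exists v; [have := ltn_ord v; lia|split].
  rewrite negb_exists => /forallP dle; rewrite !big_mkord ltnNge leq_sum //.
  by move=> i _; rewrite leqNgt.
pose q i := if i == m.+1 then v else p i.
have qE i : i < m.+1 -> q i = p i by rewrite /q; case: eqP; lia.
have qdeg i : parent_degree q m.+2 i = parent_degree p m.+1 i + (v == i).
  by rewrite parent_degreeS (eq_parent_degree _ qE) /q eqxx.
exists q; split=> i.
- by rewrite /q; case: eqP => [->|ne] im; [lia|apply: p_lt; lia].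
- by rewrite /q; case: eqP => [->|ne] im Ci; [exact: vC|apply: pC => //; lia].
rewrite qdeg leq_eqVlt => /predU1P[->|im].
  by rewrite parent_degree_ge //; have := d_gt0 m.+1 (leqnn _); lia.
by case: eqP => [<-|_]; [lia|rewrite addn0; apply: pd; lia].
Qed.

(** The bounds given by [attach_parents] are equalities, because both sides have the same sum. *)
Lemma realize_parents n :
  0 < n ->
  (forall i, i < n -> 0 < d i) ->
  (forall i, 0 < i < n -> C i -> (0 < i.-1) < d i.-1) ->
  (forall i, 0 < i < n -> 2 * i.-1 < \sum_(0 <= j < i) d j) ->
  \sum_(0 <= j < n) d j = 2 * n.-1 ->
  exists p, [/\ forall i, 0 < i < n -> p i < i,
    forall i, 0 < i < n -> C i -> p i = i.-1
    & forall i, i < n -> d i = parent_degree p n i].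
Proof.
case: n => // m _ d_gt0 dC dsum dtot.
have [p [p_lt pC pd]] := attach_parents d_gt0 dC dsum.
exists p; split=> //.
have : \sum_(i < m.+1) parent_degree p m.+1 i == \sum_(i < m.+1) d i.
  by rewrite -!(big_mkord xpredT (fun i => _ i)) dtot sum_parent_degree.
have /leqif_sum := fun (i : 'I_m.+1) (_ : true) => leqif_eq (pd i (ltn_ord i)).
move=> [_ ->] /forallP h i im.
by have /= /eqP := h (Ordinal im).
Qed.

End Realization.

(** * An order in which the degrees can be attached *)

Section DegreeOrder.

Implicit Types (d e f : seq nat).

(* With o open slots, the vertices with degrees d can be attached in order:
   attaching a vertex of degree x closes one slot and opens x - 1. *)
Fixpoint attachable o d :=
  if d is x :: d' then (0 < o) && attachable (o + x - 2) d' else true.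

Lemma attachable_prefix o d i :
  all (leq 1) d -> attachable o d -> i < size d ->
  2 * i < o + \sum_(0 <= j < i) nth 0 d j.
Proof.
elim: d o i => //= x d IHd o i /andP[x1 d1] /andP[o0 att].
case: i => [|i]; first by rewrite big_geq // addn0.
by rewrite ltnS => /(IHd _ i d1 att); rewrite big_nat_recl //=; lia.
Qed.

Lemma attachable_leaves t : attachable t (nseq t 1).
Proof. by elim: t => //= t IHt; rewrite (_ : t.+1 + 1 - 2 = t) //; lia. Qed.

Lemma leq_sumn_all m f : all (leq m) f -> m * size f <= sumn f.
Proof. by elim: f => [|y f IHf] /=; [lia|move=> /andP[my /IHf]; lia]. Qed.

(** Entries that are at least 2 never lower the number of open slots. *)
Lemma attachable_cat o f d :
  all (leq 2) f -> 0 < o -> attachable (o + sumn f - 2 * size f) d ->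
  attachable o (f ++ d).
Proof.
elim: f o => [|x f IHf] o /=; first by rewrite addn0 subn0.
move=> /andP[x2 f2] o0; rewrite o0 /= => h; apply: IHf => //; first lia.
have sum_f := leq_sumn_all f2.
by rewrite (_ : _ - _ = o + (x + sumn f) - 2 * (size f).+1) //; lia.
Qed.

Definition with_leaves e := flatten [seq [:: x; 1] | x <- e].

Lemma size_with_leaves e : size (with_leaves e) = 2 * size e.
Proof. by elim: e => //= x e ->; lia. Qed.

Lemma perm_with_leaves e : perm_eq (with_leaves e) (e ++ nseq (size e) 1).
Proof.
elim: e => //= x e IHe; rewrite perm_cons -cat1s.
apply: perm_trans (perm_cat (perm_refl [:: 1]) IHe) _.
by rewrite perm_catCA.
Qed.

Lemma nth_with_leaves e i :
  all (leq 2) e -> i < 2 * size e -> ~~ odd i -> 2 <= nth 0 (with_leaves e) i.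
Proof.
elim: e i => [|x e IHe] [|[|i]] //= /andP[x2 e2]; rewrite ?negbK //.
by move=> ie; apply: IHe => //; lia.
Qed.

(* Once the head of e is 2, so are all the other entries, and the number of open
   slots decreases to 0. *)
Lemma attachable_with_leaves o e t :
  sorted geq e -> all (leq 2) e -> (0 < o) || (size e + t == 0) ->
  o + sumn e = 3 * size e + t ->
  attachable o (with_leaves e ++ nseq t 1).
Proof.
elim: e o => [|x e IHe] o /=.
  by move=> _ _ _; rewrite addn0 add0n => ->; apply: attachable_leaves.
move=> xe /andP[x2 e2]; rewrite orbF => o0 tot.
have geq_tr : transitive geq by move=> a b c /= ab bc; apply: leq_trans bc ab.
have sum_e : x = 2 -> sumn e = 2 * size e.
  move=> x_2; have := order_path_min geq_tr xe; rewrite x_2.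
  elim: e e2 {IHe xe tot} => //= y e IHe /andP[y2 e2] /andP[y2' /(IHe e2)].
  lia.
rewrite o0 /= (_ : 0 < o + x - 2) /=; last lia.
apply: IHe => //; [exact: path_sorted xe | | lia].
(* The pair [x, 1] changes the slots by [x - 3]. For [x = 2] the balance leaves exactly [size e + t]
   slots; for [x >= 3] the number does not drop. *)
have [/sum_e|x_ne2] := eqVneq x 2; lia.
Qed.

End DegreeOrder.

Lemma tree_with_matching n (s : n.-tuple nat) (l := count_mem 1 s) :
  2 < n -> tree_degree_sequence s ->
  exists2 T, trees_with s T & (minn n (2 * (n - l)))./2 <= matching_number T.
Proof.
move=> n2 [s_sorted _ s1 s_sum].
pose e : seq nat := rev [seq x <- s | x != 1]; pose k := size e.
have perm_e : perm_eq (e ++ nseq l 1) s.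
  rewrite perm_sym -(perm_filterC (predC (pred1 1)) s) perm_cat //.
    by rewrite /e perm_sym perm_rev.
  rewrite (@eq_filter _ _ (pred1 1)) => [|x]; last by rewrite /= negbK.
  by rewrite /l -size_filter -(all_pred1P _ _ (filter_all _ _)).
have sz_s : k + l = n.
  by rewrite -(size_tuple s) -(perm_size perm_e) size_cat size_nseq.
have sum_e : sumn e + l + 2 = 2 * n.
  by rewrite -s_sum -(perm_sumn perm_e) sumn_cat sumn_nseq mul1n.
have e2 : all (leq 2) e.
  apply/allP => x; rewrite mem_rev mem_filter => /andP[x1 /(allP s1)]; lia.
have e_sorted : sorted geq e.
  by rewrite /e rev_sorted; apply: sorted_filter s_sorted; apply: leq_trans.
(* [g] holds the last [minn k l] non-leaf degrees, those to be followed by a leaf; [f] is empty if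
   [k <= l]. *)
pose f : seq nat := take (k - l) e; pose g : seq nat := drop (k - l) e.
have fgE : f ++ g = e by apply: cat_take_drop.
have [f2 g2] : all (leq 2) f /\ all (leq 2) g.
  by apply/andP; rewrite -all_cat fgE.
have sz_f : size f = k - l by rewrite size_take -/k; case: ltnP; lia.
have sz_g : size g = k - (k - l) by rewrite size_drop.
have sum_fg : sumn f + sumn g = sumn e by rewrite -sumn_cat fgE.
have sum_f := leq_sumn_all f2.
pose d := f ++ with_leaves g ++ nseq (l - k) 1.
have perm_d : perm_eq d s.
  apply: perm_trans perm_e; rewrite -fgE -catA perm_cat2l.
  apply: perm_trans (perm_cat (perm_with_leaves g) (perm_refl _)) _.
  by rewrite -catA perm_cat2l -nseqD sz_g (_ : _ + _ = l) //; lia.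
have sz_d : size d = n by rewrite (perm_size perm_d) size_tuple.
have d1 : all (leq 1) d by rewrite (perm_all _ perm_d).
(* The initial value 2 compensates for the root having no parent: after a root of degree [x],
   exactly [x] slots are open. *)
have att_d : attachable 2 d.
  apply: attachable_cat => //; apply: attachable_with_leaves => //; last lia.
    exact: drop_sorted.
  by rewrite (_ : 0 < _) //; lia.
pose b := minn n (2 * k).
(* So [f ++ with_leaves g] fills exactly the first [b] positions. *)
have bE : b = size f + 2 * size g by rewrite /b; lia.
have d_gt0 i : i < n -> 0 < nth 0 d i.
  by move=> i_n; apply: (all_nthP 0 d1); rewrite sz_d.
have [|||||p [p_lt pC pd]] :=
  @realize_parents (nth 0 d) (fun i => odd (b - i)) n => //.
- lia.
(* As [b - i] is odd, position [i.-1] lies in [f] or at an even offset in [with_leaves g], hence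
   carries a non-leaf degree. *)
- move=> i i_n Ci; apply: (@leq_trans 2); first by case: (0 < i.-1).
  rewrite nth_cat; case: (ltnP i.-1) => [i_f|f_i]; first exact: (all_nthP 0 f2).
  rewrite nth_cat size_with_leaves; case: (ltnP (i.-1 - _)) => [i_g|]; last lia.
  by apply: nth_with_leaves => //; lia.
- move=> i i_n; have := @attachable_prefix 2 d i d1 att_d; rewrite sz_d; lia.
- rewrite -{1}sz_d -(big_nth 0 xpredT id) -sumnE (perm_sumn perm_d); lia.
have n0 : 0 < n by lia.
exists (parent_tree p_lt).
  split.
    by split; [exact: parent_tree_connected|exact: parent_tree_acyclic].
  rewrite (parent_tree_degree_sequence p_lt sz_d pd).
  apply: (sorted_eq leq_trans anti_leq); rewrite ?sort_sorted //.
    exact: leq_total.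
  by rewrite perm_sort.
rewrite (_ : n - l = k); last lia.
apply: parent_tree_matching; first exact: geq_minl.
by move=> i i0 Ci; apply: pC => //; rewrite i0 /=; lia.
Qed.

(** * Extremal values *)

Lemma card_trees_with n (s : n.-tuple nat) T : trees_with s T -> #|T| = n.
Proof.
by move=> [_ /(congr1 size)]; rewrite size_sort size_map -cardE size_tuple.
Qed.

Lemma card_leaves n (s : n.-tuple nat) T :
  trees_with s T -> #|leaves T| = count_mem 1 s.
Proof.
move=> [_ <-]; rewrite count_sort count_map -size_filter cardE.
rewrite enumT; congr size; apply: eq_filter => x.
by rewrite !inE.
Qed.

Lemma tree_large_indep n (s : n.-tuple nat) T :
  2 < n -> trees_with s T ->
  exists2 S : {set T}, independent S & maxn (count_mem 1 s) (uphalf n) <= #|S|.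
Proof.
move=> n2 sT; have [[conT acT] _] := sT.
have cT := card_trees_with sT.
have [l_ge|l_lt] := leqP (uphalf n) (count_mem 1 s).
  exists (leaves T); last by rewrite (card_leaves sT).
  by apply: leaves_indep; rewrite ?cT.
by have [S indS] := acyclic_indep acT; rewrite cT; exists S.
Qed.

Lemma exists_matching (G : sgraph) :
  exists2 M : {set {set G}}, is_matching M & #|M| = matching_number G.
Proof.
have m0 : is_matching (set0 : {set {set G}}).
  apply/andP; split; first exact: sub0set.
  by apply/trivIsetP => A B; rewrite inE.
rewrite /matching_number (bigmax_eq_arg _ m0).
by case: arg_maxnP => // M mM _; exists M.
Qed.

Theorem theorem3 (R : rcfType) (n : nat) (s : n.-tuple nat) :
  2 < n -> tree_degree_sequence s ->
  let l := count_mem 1 s in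
  [/\ is_maximum (trees_with s) matching_number
        (if uphalf n <= l then n - l else n./2),
      is_minimum (trees_with s) (fun T => nullity T R)
        (if uphalf n <= l then 2 * l - n else if odd n then 1 else 0)
    & is_minimum (trees_with s) independence_number
        (if uphalf n <= l then l else uphalf n)].
Proof.
move=> n2 ts l.
set nu := (X in is_maximum _ _ X); set eta := (X in is_minimum _ _ X).
set alpha := (X in is_minimum _ independence_number X).
have ln : l <= n by rewrite -[X in _ <= X](size_tuple s) count_size.
have alphaE : alpha = maxn l (uphalf n) by rewrite /alpha; case: ifP; lia.
have nuE : nu = n - alpha by rewrite /nu /alpha; case: ifP; lia.
have etaE : eta = 2 * alpha - n.
  by rewrite /eta /alpha; case: ifP => //; case: ifP; lia.
have nu_le T : trees_with s T -> matching_number T <= nu.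
  move=> sT; have [S indS cS] := tree_large_indep n2 sT.
  apply/bigmax_leqP => M mM; have := matching_cardU_indep indS mM.
  by rewrite (card_trees_with sT) nuE alphaE; lia.
have eta_ge T : trees_with s T -> eta <= nullity T R.
  move=> sT; have [S indS cS] := tree_large_indep n2 sT.
  apply: leq_trans (nullity_indep R indS).
  by rewrite etaE alphaE (card_trees_with sT); lia.
have alpha_ge T : trees_with s T -> alpha <= independence_number T.
  move=> sT; have [S indS cS] := tree_large_indep n2 sT.
  by apply: (bigmax_sup S) => //; rewrite alphaE.
have [T sT nu_ge] := tree_with_matching n2 ts.
have [M mM cM] := exists_matching T.
(* Halving gives [minn n./2 (n - l)], which is [n - alpha]. *)
have {nu_ge} M_ge : nu <= #|M|.
  by rewrite cM; apply: leq_trans nu_ge; rewrite nuE alphaE -/l; lia.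
have cT := card_trees_with sT.
split; (split; first exists T) => //; apply/eqP; rewrite eqn_leq.
- by rewrite nu_le //= -cM.
- rewrite eta_ge // andbT; have [[_ acT] _] := sT.
  by apply: leq_trans (nullity_matching R acT mM) _; rewrite cT etaE; lia.
- rewrite alpha_ge // andbT; apply/bigmax_leqP => S indS.
  by have := matching_cardU_indep indS mM; rewrite cT; lia.
Qed.
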